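(* Let $\Gamma=(V,E)$ be a finite directed graph (multiple edges and loops allowed) with at least one edge. If $\Gamma$ is strongly connected, then $\Gamma$ has a strong directed trail decomposition consisting of self-avoiding directed trails.
   Context: A directed trail $P$ in a directed graph $\Gamma=(V,E)$ is a non-empty finite sequence of distinct directed edges $e_1,\dots,e_m$ with $\mathrm{tail}(e_{i+1})=\mathrm{head}(e_i)$ for $i=1,\dots,m-1$. Its start is $s(P)=\mathrm{tail}(e_1)$ and its terminus is $t(P)=\mathrm{head}(e_m)$. $V[P]$ denotes the set of vertices that are the head or tail of an edge of $P$. The trail is self-avoiding if for all $i\neq j$ in $\{1,\dots,m\}$, $\mathrm{tail}(e_i)\neq\mathrm{tail}(e_j)$ and $\mathrm{head}(e_i)\neq\mathrm{head}(e_j)$ (so $\mathrm{head}(e_m)=\mathrm{tail}(e_1)$ is allowed). A strong directed trail decomposition of $\Gamma$ is a finite sequence of directed trails $(P_0,\dots,P_n)$ such that: (1) the edge sets of $P_0,\dots,P_n$ are pairwise disjoint and their union is $E$; (2) $s(P_0)=t(P_0)$; (3) for each $i=1,\dots,n$, the set $V[P_i]\cap\bigcup_{j=0}^{i-1}V[P_j]$ is non-empty and equals $\{s(P_i),t(P_i)\}$. $\Gamma$ is strongly connected if for all $u,v\in V$ either $u=v$, or there are a directed trail from $u$ to $v$ and a directed trail from $v$ to $u$. *)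

(* Defs.v *)
From mathcomp Require Import all_boot.

Set Implicit Arguments.
Unset Strict Implicit.
Unset Printing Implicit Defensive.

(* Edges form a type of their own, so loops and multiple edges are allowed. *)
Record digraph := Digraph {
  vertex : finType;
  edge : finType;
  edge_tail : edge -> vertex;
  edge_head : edge -> vertex
}.

(* The first edge is kept apart from the others: the sequence of edges is
   non-empty by construction, so start and terminus need no default value. *)
Record trail (G : digraph) := Trail {
  first_edge : edge G;
  other_edges : seq (edge G);
  trail_uniq : uniq (first_edge :: other_edges);
  trail_path :
    path (fun e f => edge_tail f == edge_head e) first_edge other_edges
}.

Definition trail_edges (G : digraph) (P : trail G) : seq (edge G) :=
  first_edge P :: other_edges P.

Definition trail_start (G : digraph) (P : trail G) : vertex G :=
  edge_tail (first_edge P).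

Definition trail_end (G : digraph) (P : trail G) : vertex G :=
  edge_head (last (first_edge P) (other_edges P)).

Definition trail_vertices (G : digraph) (P : trail G) : {set vertex G} :=
  [set v | (v \in [seq edge_tail e | e <- trail_edges P])
        || (v \in [seq edge_head e | e <- trail_edges P])].

Definition self_avoiding (G : digraph) (P : trail G) : bool :=
  uniq [seq edge_tail e | e <- trail_edges P] &&
  uniq [seq edge_head e | e <- trail_edges P].

Definition trail_from_to (G : digraph) (u v : vertex G) : Prop :=
  exists P : trail G, trail_start P = u /\ trail_end P = v.

Definition strongly_connected (G : digraph) : Prop :=
  forall u v : vertex G, u = v \/ (trail_from_to u v /\ trail_from_to v u).

Definition attachment (G : digraph) (n : nat) (P : 'I_n.+1 -> trail G)
    (i : 'I_n.+1) : {set vertex G} :=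
  trail_vertices (P i) :&: \bigcup_(j < n.+1 | j < i) trail_vertices (P j).

Record strong_trail_decomposition (G : digraph) (n : nat)
    (P : 'I_n.+1 -> trail G) : Prop := StrongTrailDecomposition {
  std_disjoint : forall i j : 'I_n.+1, i != j ->
    [disjoint trail_edges (P i) & trail_edges (P j)];
  std_cover : forall e : edge G, exists i : 'I_n.+1, e \in trail_edges (P i);
  std_closed : trail_start (P ord0) = trail_end (P ord0);
  std_attach : forall i : 'I_n.+1, 0 < i ->
    attachment P i != set0 /\
    attachment P i = [set trail_start (P i); trail_end (P i)]
}.

(* Main.v *)
Require Import Defs.
From mathcomp Require Import all_boot.

Set Implicit Arguments.
Unset Strict Implicit.
Unset Printing Implicit Defensive.

(** Ear decomposition. Given a vertex set [U] and an edge leaving a vertex of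
    [U], follow that edge and then a simple path back until [U] is first hit:
    the result is a self-avoiding trail meeting [U] exactly in its endpoints.
    With [U] a singleton this yields the initial closed trail; with [U] the set
    of vertices visited so far it extends any decomposition that does not yet
    use all edges, because by connectivity some unused edge starts in [U]. *)

Section Ears.

Variable G : digraph.
Implicit Types (U : {set vertex G}) (e f : edge G) (u v y : vertex G).
Implicit Types (P : nat -> trail G) (Q : trail G).

Definition adjacent u v := [exists e, (edge_tail e == u) && (edge_head e == v)].

Lemma adjacent_edge e : adjacent (edge_tail e) (edge_head e).
Proof. by apply/existsP; exists e; rewrite !eqxx. Qed.

Lemma path_adjacent e (s : seq (edge G)) :
  path (fun e f => edge_tail f == edge_head e) e s ->
  path adjacent (edge_head e) (map (@edge_head G) s).
Proof.
elim: s e => //= f s IHs e /andP[/eqP ef /IHs ->].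
by rewrite -ef adjacent_edge.
Qed.

Lemma strongly_connected_connect u v :
  strongly_connected G -> connect adjacent u v.
Proof.
move=> hG; have [-> | [[Q [<- <-]] _]] := hG u v; first exact: connect0.
apply/connectP; exists (map (@edge_head G) (trail_edges Q)); last by rewrite /= last_map.
by rewrite /= adjacent_edge path_adjacent ?trail_path.
Qed.

(** A path from inside [U] to outside must cross the boundary at some step; the induction finds the
    first such step. *)
Lemma exists_exiting_edge U u v :
  connect adjacent u v -> u \in U -> v \notin U ->
  exists e, edge_tail e \in U /\ edge_head e \notin U.
Proof.
move=> /connectP[p]; elim: p u => [|w p IHp] u /=.
  by move=> _ -> ->.
case/andP=> /existsP[e /andP[/eqP te /eqP he]] pth ev uU vU.
have [wU | wU] := boolP (w \in U); first exact: IHp pth ev wU vU.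
by exists e; rewrite te he.
Qed.

(** The path is cut at its first vertex in [U], possibly [y] itself, in which case [q] is empty. The
    [subseq] clause lets simplicity of [p] pass to [q]. *)
Lemma path_first_hit U y (p : seq (vertex G)) :
  path adjacent y p -> last y p \in U ->
  exists q, [/\ path adjacent y q, last y q \in U,
                {in belast y q, forall v, v \notin U} & subseq q p].
Proof.
elim: p y => [|w p IHp] y /=; first by exists [::].
case/andP=> yw pth lU; have [yU | yU] := boolP (y \in U).
  by exists [::].
have [q [qpth qU qN qp]] := IHp w pth lU.
exists (w :: q); split=> //=; [by rewrite yw | | by rewrite eqxx].
by move=> v; rewrite inE => /predU1P[-> | /qN].
Qed.

(** One edge is chosen for each step. Recording heads and tails separately turns simplicity of the
    vertex path into the two halves of self-avoidance. *)
Lemma path_adjacent_edges y (p : seq (vertex G)) :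
  path adjacent y p ->
  exists s, map (@edge_head G) s = p /\ map (@edge_tail G) s = belast y p.
Proof.
elim: p y => [|w p IHp] y /=; first by exists [::].
case/andP=> /existsP[e /andP[/eqP te /eqP he]] /IHp[s [hs ts]].
by exists (e :: s); rewrite /= te he hs ts.
Qed.

Lemma path_of_tails e (s : seq (edge G)) :
  map (@edge_tail G) s = belast (edge_head e) (map (@edge_head G) s) ->
  path (fun e f => edge_tail f == edge_head e) e s.
Proof. by elim: s e => //= f s IHs e [-> /IHs ->]; rewrite eqxx. Qed.

(** The clause on [other_edges] serves later to show that the ear is new: when [U] is the set of
    covered vertices, an edge with tail outside [U] cannot be covered. *)
Lemma ear_exists U e :
  strongly_connected G -> edge_tail e \in U ->
  exists Q, [/\ first_edge Q = e, trail_end Q \in U,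
    {in other_edges Q, forall f, edge_tail f \notin U}, self_avoiding Q
    & trail_vertices Q :&: U = [set trail_start Q; trail_end Q]].
Proof.
move=> hG xU.
have /connectP[p0 pth0 ep0] :=
  strongly_connected_connect (edge_head e) (edge_tail e) hG.
case: (shortenP pth0) ep0 => p1 pth1 uniq1 _ ep1 {p0 pth0}.
have [] := path_first_hit (U := U) pth1; first by rewrite -ep1.
move=> p [pth pU pN sub_p].
have {p1 pth1 ep1 sub_p uniq1} uniq_p : uniq (edge_head e :: p).
  by apply: subseq_uniq uniq1; rewrite /= eqxx.
have [s [hs ts]] := path_adjacent_edges pth.
have uniq_b : uniq (belast (edge_head e) p).
  by move: uniq_p; rewrite lastI rcons_uniq => /andP[].
(* The tail of [e] lies in [U], whereas all later tails precede the first hit and so lie outside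
   [U]. *)
have uniq_t : uniq (edge_tail e :: map (@edge_tail G) s).
  rewrite /= ts uniq_b andbT; apply/negP => /pN; by rewrite xU.
have uniq_s : uniq (e :: s) by apply: (@map_uniq _ _ (@edge_tail G)).
have pth_s : path (fun e f => edge_tail f == edge_head e) e s.
  by apply: path_of_tails; rewrite hs.
have end_s : edge_head (last e s) = last (edge_head e) p by rewrite -hs last_map.
exists (Trail uniq_s pth_s); split=> //=.
- by rewrite /trail_end /= end_s.
- by move=> f fs; apply: pN; rewrite -ts map_f.
- by rewrite /self_avoiding /trail_edges /= hs -!cons_uniq uniq_t.
rewrite /trail_vertices /trail_start /trail_end /trail_edges /= end_s hs ts.
(* Splitting off the last vertex leaves [belast], which avoids [U]; only the two endpoints can
   survive the intersection. *)
apply/setP=> v; rewrite (lastI (edge_head e)) in_setI in_set in_set2 mem_rcons !in_cons.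
have [-> | vx] := eqVneq v (edge_tail e); first by rewrite xU.
have [-> | vl] := eqVneq v (last _ p); first by rewrite pU !orbT.
by rewrite /= orbb; apply/negP=> /andP[/pN/negP].
Qed.

(** The bound is strict: index [i] gives what precedes [P i], and a sequence ending at [P n] covers
    [covered_edges P n.+1]. *)
Definition covered_edges P n : {set edge G} :=
  \bigcup_(i < n) [set e in trail_edges (P i)].

Definition covered_vertices P n : {set vertex G} :=
  \bigcup_(i < n) trail_vertices (P i).

Lemma mem_covered_edges P n i e :
  i < n -> e \in trail_edges (P i) -> e \in covered_edges P n.
Proof.
by move=> ltin eP; apply/bigcupP; exists (Ordinal ltin) => //; rewrite inE.
Qed.

Lemma covered_tail P n e : e \in covered_edges P n ->
  edge_tail e \in covered_vertices P n.
Proof.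
case/bigcupP=> i _; rewrite inE => eP.
by apply/bigcupP; exists i; rewrite // inE map_f.
Qed.

Lemma covered_head P n e : e \in covered_edges P n ->
  edge_head e \in covered_vertices P n.
Proof.
case/bigcupP=> i _; rewrite inE => eP.
by apply/bigcupP; exists i; rewrite // inE map_f ?orbT.
Qed.

(* Trails are indexed by [nat], and only those of index at most [n] matter, so
   that appending a trail needs no reindexing of ordinals. *)
Record ear_sequence P n : Prop := EarSequence {
  ear_disjoint : forall i, i <= n ->
    {in trail_edges (P i), forall e, e \notin covered_edges P i};
  ear_closed : trail_start (P 0) = trail_end (P 0);
  ear_attach : forall i, 0 < i <= n ->
    trail_vertices (P i) :&: covered_vertices P i
      = [set trail_start (P i); trail_end (P i)];
  ear_self_avoiding : forall i, i <= n -> self_avoiding (P i)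
}.

Definition extend P n Q i := if i <= n then P i else Q.

Lemma covered_edges_extend P n Q m : m <= n.+1 ->
  covered_edges (extend P n Q) m = covered_edges P m.
Proof.
move=> lemn; apply: eq_bigr => i _.
by rewrite /extend -ltnS (leq_trans (ltn_ord i) lemn).
Qed.

Lemma covered_vertices_extend P n Q m : m <= n.+1 ->
  covered_vertices (extend P n Q) m = covered_vertices P m.
Proof.
move=> lemn; apply: eq_bigr => i _.
by rewrite /extend -ltnS (leq_trans (ltn_ord i) lemn).
Qed.

Lemma ear_sequence_extend P n Q :
    ear_sequence P n ->
    {in trail_edges Q, forall e, e \notin covered_edges P n.+1} ->
    self_avoiding Q ->
    trail_vertices Q :&: covered_vertices P n.+1
      = [set trail_start Q; trail_end Q] ->
  ear_sequence (extend P n Q) n.+1.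
Proof.
move=> [dP cP aP sP] dQ sQ aQ; split=> // i.
- move=> lein; rewrite covered_edges_extend // /extend.
  case: leqP => [/dP // | ltni].
  by have -> : i = n.+1 by apply/eqP; rewrite eqn_leq lein.
- case/andP=> i_gt0 lein; rewrite covered_vertices_extend // /extend.
  case: leqP => [le_i_n | ltni]; first by apply: aP; rewrite i_gt0.
  by have -> : i = n.+1 by apply/eqP; rewrite eqn_leq lein.
by move=> lein; rewrite /extend; case: leqP => [/sP |].
Qed.

(** If the tail of [e] is not covered, some edge leaves the covered vertices; its head is uncovered,
    hence so is the edge. *)
Lemma uncovered_edge_from_covered P n e :
  strongly_connected G -> e \notin covered_edges P n.+1 ->
  exists f, edge_tail f \in covered_vertices P n.+1
         /\ f \notin covered_edges P n.+1.
Proof.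
move=> hG eN.
have [tU | tU] := boolP (edge_tail e \in covered_vertices P n.+1).
  by exists e.
have e0U : edge_tail (first_edge (P 0)) \in covered_vertices P n.+1.
  by apply/covered_tail/(mem_covered_edges (i := 0)); rewrite ?mem_head.
have [f [tf hf]] := exists_exiting_edge
  (strongly_connected_connect _ _ hG) e0U tU.
by exists f; split=> //; apply: contra hf; apply: covered_head.
Qed.

(** Induction on the number of uncovered edges: each new ear lowers it. *)
Lemma ear_sequence_complete P n :
  strongly_connected G -> ear_sequence P n ->
  exists P' n', ear_sequence P' n' /\ covered_edges P' n'.+1 = setT.
Proof.
move=> hG; have [k] := ubnP #|~: covered_edges P n.+1|.
elim: k P n => // k IHk P n ltk earP.
have [all_cov | [e]] := set_0Vmem (~: covered_edges P n.+1).
  by exists P, n; rewrite -[RHS]setC0 -all_cov setCK.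
rewrite inE => /(uncovered_edge_from_covered hG)[f [tf fN]].
have [Q [Qf _ Qother sQ aQ]] := ear_exists hG tf.
have dQ : {in trail_edges Q, forall e, e \notin covered_edges P n.+1}.
  move=> g; rewrite inE Qf => /predU1P[-> // | /Qother].
  by apply: contra; apply: covered_tail.
apply: (IHk _ _ _ (ear_sequence_extend earP dQ sQ aQ)).
move: ltk; rewrite ltnS; apply: leq_trans; apply: proper_card.
rewrite properEneq setCS.
apply/andP; split.
  (* The first edge [f] of the new ear witnesses strictness. *)
  apply: contraNneq fN => /setP/(_ f); rewrite !inE => /negb_inj <-.
  by apply: (mem_covered_edges (i := n.+1)); rewrite // /extend ltnn -Qf mem_head.
rewrite -(covered_edges_extend P Q (leqnn n.+1)).
by rewrite {2}/covered_edges big_ord_recr subsetUl.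
Qed.

Lemma ear_sequence_start :
  strongly_connected G -> 0 < #|edge G| -> exists P, ear_sequence P 0.
Proof.
move=> hG /card_gt0P[e _].
(* With [U] reduced to the tail of [e], ending in [U] means that the trail is closed. *)
have [Q [Qe Qend _ sQ _]] := ear_exists hG (set11 (edge_tail e)).
exists (fun=> Q); split=> //.
- by move=> [] // _ f _; rewrite /covered_edges big_ord0 inE.
- by move: Qend; rewrite inE /trail_start Qe => /eqP ->.
- by move=> [].
Qed.

Lemma ear_sequence_decomposition P n :
  ear_sequence P n -> covered_edges P n.+1 = setT ->
  strong_trail_decomposition (fun i : 'I_n.+1 => P i).
Proof.
move=> [dP cP aP _] covP; split=> //.
(* [ear_disjoint] compares a trail with earlier ones only, so the indices are ordered first. *)
- have disj (i j : nat) : i < j -> j <= n ->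
      [disjoint trail_edges (P i) & trail_edges (P j)].
    move=> ltij lejn; rewrite disjoint_sym disjoint_subset.
    apply/subsetP => e /(dP _ lejn); apply: contra.
    exact: mem_covered_edges ltij.
  move=> i j; rewrite -val_eqE neq_ltn => /orP[] /disj dij.
    exact: dij (ltn_ord j).
  by rewrite disjoint_sym; exact: dij (ltn_ord i).
- move=> e; have : e \in covered_edges P n.+1 by rewrite covP inE.
  by case/bigcupP=> i _; rewrite inE; exists i.
move=> i i_gt0.
have -> : attachment (fun i : 'I_n.+1 => P i) i
        = [set trail_start (P i); trail_end (P i)].
  rewrite -aP; last by rewrite i_gt0 -ltnS ltn_ord.
  rewrite /attachment /covered_vertices.
  (* The union over ['I_i] becomes a filtered union over ['I_n.+1], as in [attachment]. *)
  by rewrite (big_ord_widen n.+1 (fun j => trail_vertices (P j)) (ltnW (ltn_ord i))).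
by split=> //; apply/set0Pn; exists (trail_start (P i)); rewrite set21.
Qed.

End Ears.

Theorem lemma3p2 (G : digraph) (hE : 0 < #|edge G|)
    (hG : strongly_connected G) :
  exists (n : nat) (P : 'I_n.+1 -> trail G),
    strong_trail_decomposition P /\ forall i : 'I_n.+1, self_avoiding (P i).
Proof.
have [P0 /(ear_sequence_complete hG)[P [n [earP covP]]]] :=
  ear_sequence_start hG hE.
exists n, (fun i => P i); split; first exact: ear_sequence_decomposition.
by move=> i; apply: (ear_self_avoiding earP); rewrite -ltnS.
Qed.
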